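(* Let $I\subset R=\mathbf{k}[x_1,\dots,x_n]$ be an artinian monomial ideal and let $\mathcal{B}_{n-1}(I)$ be the set of multidegrees $\nu\in\mathbb{N}^n$ such that $H_{n-1,\nu}(\mathbb{K}(I))\neq 0$. For $\nu\in\mathbb{N}^n$ let $\bar\nu\in\mathbb{N}^n$ be given by $\bar\nu_i=\nu_i-1$ if $\nu_i>0$ and $\bar\nu_i=\nu_i$ otherwise. Then a Stanley decomposition of $R/I$ is given by $$R/I\;\simeq\;\bigoplus_{\mu}\ \mathbf{k}\cdot x^{\mu},$$ where the direct sum runs over all $\mu\in\mathbb{N}^n$ such that $x^{\mu}$ divides $x^{\bar\nu}$ for some $\nu\in\mathcal{B}_{n-1}(I)$.
   Context: $\mathbf{k}$ is a field of characteristic $0$, $R=\mathbf{k}[x_1,\dots,x_n]$ with its $\mathbb{N}^n$-grading, and $x^\mu=x_1^{\mu_1}\cdots x_n^{\mu_n}$. A monomial ideal $I$ is artinian if $R/I$ is zero-dimensional (equivalently, for every $i$ a power $x_i^{a_i}$, $a_i>0$, is a minimal generator of $I$). Koszul homology: let $\mathcal{V}$ be the $\mathbf{k}$-vector space with basis $x_1,\dots,x_n$. $\mathbb{K}(I)$ is the complex with modules $I\otimes_{\mathbf{k}}\wedge^i\mathcal{V}$ in homological degree $i$ and differential $\partial(m\otimes x_{j_1}\wedge\cdots\wedge x_{j_i})=\sum_{l=1}^i(-1)^{l+1}x_{j_l}m\otimes x_{j_1}\wedge\cdots\wedge\widehat{x_{j_l}}\wedge\cdots\wedge x_{j_i}$.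 It is $\mathbb{N}^n$-graded (the multidegree of $x^\mu\otimes x_{j_1}\wedge\cdots\wedge x_{j_i}$ is $\mu+e_{j_1}+\cdots+e_{j_i}$), and $H_{i,\nu}(\mathbb{K}(I))\cong \mathrm{Tor}^R_{i,\nu}(I,\mathbf{k})$ is the multidegree-$\nu$ part of its $i$-th homology. Stanley decomposition of $S=R/I$: a representation of $S$, as a $\mathbf{k}$-vector space, as a finite direct sum $S=\bigoplus_{\mu\in F}x^\mu\,\mathbf{k}[\mathbf{x}_\mu]$ where $F\subset\mathbb{N}^n$ is finite and each $\mathbf{x}_\mu$ is a (possibly empty) subset of the variables; monomials not in $I$ are identified with their classes in $R/I$. *)

(* Defs.v *)
From mathcomp Require Export all_boot all_algebra.
From mathcomp Require Export generic_quotient ring_quotient finmap.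
From mathcomp Require Export mpoly.

Set Implicit Arguments.
Unset Strict Implicit.
Unset Printing Implicit Defensive.

Import GRing.Theory.
Local Open Scope ring_scope.
Local Open Scope quotient_scope.

Definition prime_ideal (A : comNzRingType) (P : {pred A}) : Prop :=
  idealr_closed P /\ prime_idealr_closed P.

Definition prime_chain (A : comNzRingType) (d : nat)
    (P : 'I_d.+1 -> {pred A}) : Prop :=
  (forall i, prime_ideal (P i)) /\
  (forall i j : 'I_d.+1, (i < j)%N ->
     {subset P i <= P j} /\ ~ {subset P j <= P i}).

Definition krull_dim_eq (A : comNzRingType) (d : nat) : Prop :=
  (exists P : 'I_d.+1 -> {pred A}, prime_chain P) /\
  ~ (exists P : 'I_d.+2 -> {pred A}, prime_chain P).

Section MonomialIdeals.
Variables (k : fieldType) (n : nat).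
Local Notation R := {mpoly k[n]}.

(* I is the ideal generated by the monomials x^m, m in G. *)
Definition monomial_ideal (I : idealr R) : Prop :=
  exists G : 'X_{1..n} -> Prop, forall p : R,
    p \in I <->
    exists s : seq (R * 'X_{1..n}),
      (forall t, t \in s -> G t.2) /\ p = \sum_(t <- s) t.1 * 'X_[t.2].

(* Elements of idealr are proper ideals, so R/I is a nonzero ring. *)
Definition artinian_monomial_ideal (I : idealr R) : Prop :=
  monomial_ideal I /\ krull_dim_eq {ideal_quot I} 0.

(* R (x) /\V, where V has basis x_0, ..., x_(n-1): f stands for the sum over S
   of f S (x) e_S, with e_S = x_{j_1} /\ ... /\ x_{j_i} if
   S = {j_1 < ... < j_i}. *)
Definition koszul : Type := {ffun {set 'I_n} -> R}.

(* If j = j_l is the l-th element of S (counted from 1), the sign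
   (-1)^(l+1) = (-1)^(l-1) is given by the number of elements of S below j. *)
Definition koszul_d (f : koszul) : koszul :=
  [ffun T : {set 'I_n} => \sum_(S : {set 'I_n}) \sum_(j in S | S :\ j == T)
     (-1) ^+ #|[set l in S | (l < j)%N]| * 'X_j * f S].

Definition mdeg_wedge (S : {set 'I_n}) : 'X_{1..n} :=
  [multinom nat_of_bool (i \in S) | i < n].

(* f lies in the multidegree nu part of I (x) /\^i V. *)
Definition koszul_chain (I : idealr R) (i : nat) (nu : 'X_{1..n})
    (f : koszul) : Prop :=
  forall S : {set 'I_n},
    [/\ f S \in I,
        f S != 0 -> #|S| = i
      & forall m, m \in msupp (f S) -> (m + mdeg_wedge S)%MM = nu].

(* The differential preserves multidegrees, so the multidegree nu part of the
   homology is the homology of the multidegree nu part of the complex. *)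
Definition koszul_cycle (I : idealr R) (i : nat) (nu : 'X_{1..n})
    (f : koszul) : Prop :=
  koszul_chain I i nu f /\ koszul_d f = [ffun=> 0].

Definition koszul_boundary (I : idealr R) (i : nat) (nu : 'X_{1..n})
    (f : koszul) : Prop :=
  exists g : koszul, koszul_chain I i.+1 nu g /\ f = koszul_d g.

(* The quotient cycles / boundaries is nonzero. *)
Definition koszul_homology_neq0 (I : idealr R) (i : nat) (nu : 'X_{1..n}) :
    Prop :=
  exists f : koszul, koszul_cycle I i nu f /\ ~ koszul_boundary I i nu f.

(* q belongs to k[x_i | i in v]. *)
Definition in_subalgebra (v : {set 'I_n}) (q : R) : Prop :=
  forall m, m \in msupp q -> forall i, i \notin v -> m i = 0%N.

(* R/I is the direct sum of the x^mu k[v mu], for mu in F: F is finite, and the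
   linear map from the direct sum to R/I sending each x^mu q to its class is
   bijective.  In particular each x^mu k[v mu] embeds in R/I. *)
Definition stanley_decomposition (I : idealr R)
    (F : 'X_{1..n} -> Prop) (v : 'X_{1..n} -> {set 'I_n}) : Prop :=
  exists E : {fset 'X_{1..n}},
    (forall mu, F mu <-> mu \in E) /\
    forall s : {ideal_quot I},
      exists! q : {ffun E -> R},
        (forall mu : E, in_subalgebra (v (val mu)) (q mu)) /\
        s = \pi_{ideal_quot I} (\sum_(mu : E) 'X_[val mu] * q mu).

Definition mbar (nu : 'X_{1..n}) : 'X_{1..n} :=
  [multinom (nu i).-1 | i < n].

End MonomialIdeals.

(* Main.v *)
Require Import Defs.
From mathcomp Require Import all_boot all_algebra.
From mathcomp Require Import ring zify.
From Stdlib Require Import Classical_Prop.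

(** The statement is about the socle of R/I. Write 1 = (1,...,1) and e_[n] for
    the generator of the top exterior power of V. The Koszul complex of R is
    exact in degree n-1 (except, if n = 1, for the constants, which are not in
    I), and its part of degree n and multidegree nu is spanned by x^(nu-1)
    e_[n], or zero if some nu_i is 0. So a nonzero (n-1)-cycle of multidegree
    nu is a scalar multiple of d(x^(nu-1) e_[n]), whose components are, up to
    sign, the x_j x^(nu-1). This cycle has coefficients in I iff every x_j
    x^(nu-1) is in I, and it bounds over I iff x^(nu-1) is in I. Hence
    H_(n-1,nu) is nonzero exactly when nu = mu + 1 with x^mu a nonzero socle
    monomial of R/I ([koszul_homology_codim1P]); then mbar nu = mu.

    Since I is artinian, the degrees of the monomials outside I are bounded
    ([artinian_mdeg_bound]): if no power of x_i lay in I, then I would be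
    contained in the prime generated by the x_j with j != i, which lies
    strictly below the maximal ideal of all variables. So every monomial
    outside I divides a socle monomial ([socle_above]), and the divisors of
    socle monomials are outside I. The sum in the theorem thus runs over all
    monomials outside I, whose classes form a basis of R/I because I is
    monomial ([stanley_standard]). *)

Set Implicit Arguments.
Unset Strict Implicit.
Unset Printing Implicit Defensive.

Import GRing.Theory.
Local Open Scope ring_scope.
Local Open Scope quotient_scope.

Section MonomialIdeals.
Variables (k : fieldType) (n : nat) (I : idealr {mpoly k[n]}).
Local Notation R := {mpoly k[n]}.
Implicit Types (p : R) (m mu nu : 'X_{1..n}).

(** * Membership in a monomial ideal *)

Lemma memI_unitZ (c : k) p : c != 0 -> (c *: p \in I) = (p \in I).
Proof.
move=> c0; apply/idP/idP => [cpI|pI]; last by rewrite -mul_mpolyC idealMr.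
by rewrite -[p]scale1r -(mulVf c0) -scalerA -mul_mpolyC idealMr.
Qed.

Lemma memI_lem m m' : (m <= m')%MM -> 'X_[m] \in I -> 'X_[m'] \in I.
Proof. by move=> /submK <- mI; rewrite mpolyXD idealMr. Qed.

Lemma memI_supp p : {in msupp p, forall m, 'X_[m] \in I} -> p \in I.
Proof.
move=> suppI; rewrite (mpolyE p) big_seq rpred_sum // => m /suppI mI.
by rewrite -mul_mpolyC idealMr.
Qed.

(** Each monomial of a sum of multiples of generators is a multiple of one of
    these generators; with [memI_supp], this makes membership in a monomial
    ideal a condition on the support alone. *)
Lemma monomial_ideal_supp p m :
  monomial_ideal I -> p \in I -> m \in msupp p -> 'X_[m] \in I.
Proof.
move=> [G defI] /defI[s [sG ->]] /msupp_sum_le/flattenP[_ /mapP[t + ->]].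
rewrite mem_filter /= => ts; rewrite (perm_mem (msuppMX _ _)).
case/mapP=> m' _ ->; rewrite addmC mpolyXD idealMr //.
apply/defI; exists [:: (1, t.2)]; split; last by rewrite big_seq1 mul1r.
by move=> u; rewrite inE => /eqP->; exact: (sG t).
Qed.

(** * Monomials outside an artinian monomial ideal *)

(** The kernel of the map induced by [phi] on R/I, when [phi] vanishes on I.
    It is read off a chosen representative, which is harmless by [repr_pi]. *)
Definition quot_ker (S : nzRingType) (phi : R -> S) : {pred {ideal_quot I}} :=
  [pred s | phi (repr s) == 0].

Lemma repr_pi (S : nzRingType) (phi : {rmorphism R -> S}) p :
  {in I, phi =1 fun=> 0} -> phi (repr (\pi_{ideal_quot I} p)) = phi p.
Proof.
move=> phiI; apply/eqP; rewrite -subr_eq0 -rmorphB; apply/eqP/phiI.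
by rewrite Quotient.idealrBE reprK.
Qed.

Lemma prime_ideal_ker (S : idomainType) (phi : {rmorphism R -> S}) :
  {in I, phi =1 fun=> 0} ->
  prime_ideal (quot_ker phi).
Proof.
move=> phiI; have phi_pi p := repr_pi p phiI.
split; first split.
- by rewrite inE -[0](rmorph0 \pi_{ideal_quot I}) phi_pi rmorph0.
- by rewrite inE -[1](rmorph1 \pi_{ideal_quot I}) phi_pi rmorph1 oner_eq0.
- move=> a u v; rewrite !inE -[a]reprK -[u]reprK -[v]reprK.
  rewrite -rmorphM -rmorphD !phi_pi rmorphD rmorphM => /eqP-> /eqP->.
  by rewrite mulr0 addr0.
- move=> u v; rewrite !inE -[u]reprK -[v]reprK -rmorphM !phi_pi rmorphM.
  by rewrite mulf_eq0.
Qed.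

(** Otherwise every monomial of I involves some x_j with j != i.  The evaluation
    [phi] sending x_i to 'X and the other variables to 0 then vanishes on I, and
    so does [psi], its value at 'X = 0.  The kernel of [psi] contains x_i and
    that of [phi] does not: they form a chain of primes of length 1 in R/I. *)
Lemma artinian_pure_power (i : 'I_n) :
  artinian_monomial_ideal I -> exists a, 'X_i ^+ a \in I.
Proof.
move=> [monI [_ noChain]]; apply: NNPP => noPower; apply: noChain.
pose h j : {poly k} := if j == i then 'X else 0.
pose phi : {rmorphism R -> {poly k}} := mmap polyC h.
pose psi : {rmorphism R -> k} := horner_eval 0 \o phi.
have phiX j : phi 'X_j = h j by rewrite /= mmapX mmap1U.
have phiI : {in I, phi =1 fun=> 0}.
  move=> p pI; rewrite (mpolyE p) raddf_sum big_seq big1 // => m mp.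
  have mI : 'X_[m] \in I by exact: monomial_ideal_supp mp.
  rewrite /= mmapZ mmapX /mmap1.
  have [j /andP[ji mj0]] : exists j, (j != i) && (m j != 0%N).
    apply/existsP; apply: contraT; rewrite negb_exists => /forallP m_i.
    (* A monomial of I free of the x_j with j != i would be a power of x_i. *)
    case: noPower; exists (m i); rewrite mpolyXn.
    suff <- : m = (U_(i) *+ m i)%MM by [].
    apply/mnmP => j; rewrite mulmnE mnm1E eq_sym.
    have := m_i j; case: (j =P i) => [->|_] /=; first by rewrite mul1n.
    by rewrite negbK => /eqP.
  rewrite (bigD1 j) //= /h (negPf ji) expr0n (negPf mj0).
  by rewrite mul0r mulr0.
have psiE p : psi p = (phi p).[0] by [].
have psiI : {in I, psi =1 fun=> 0}.
  by move=> p pI; rewrite psiE phiI // horner0.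
exists (fun j : 'I_2 => if j == ord0 then quot_ker phi else quot_ker psi).
split=> [j|j j' lt_jj'].
  by case: ifP => _; apply: prime_ideal_ker.
have -> : j = ord0 by apply/val_inj; case: j j' lt_jj' => [[|[]]] // ? [[|[]]].
have -> : j' == ord0 = false by case: j' lt_jj' => [[|[]]] //; rewrite ltn0.
rewrite eqxx; split=> [s|sub].
  by rewrite !inE psiE => /eqP->; rewrite horner0.
have := sub (\pi_{ideal_quot I} 'X_i); rewrite !inE !repr_pi // psiE phiX.
rewrite /h eqxx hornerX eqxx => /(_ isT).
by rewrite polyX_eq0.
Qed.

Lemma artinian_mdeg_bound :
  artinian_monomial_ideal I ->
  exists B, forall m, 'X_[m] \notin I -> (mdeg m < B)%N.
Proof.
move=> artI.
(* If x_i^a is in I, then the monomials outside I have exponent below a at i. *)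
have bound (r : seq 'I_n) :
    exists B, forall m, 'X_[m] \notin I -> (\sum_(i <- r) m i <= B)%N.
  elim: r => [|i r [B ltB]]; first by exists 0%N => m; rewrite big_nil.
  have [a aI] := artinian_pure_power i artI.
  exists (a + B)%N => m mI; rewrite big_cons leq_add ?ltB //.
  rewrite leqNgt; apply: contra mI => /ltnW lt_am.
  move: aI; rewrite mpolyXn; apply: memI_lem.
  apply/mnm_lepP => j; rewrite mulmnE mnm1E.
  by case: eqP => [<-|//]; rewrite mul1n.
have [B ltB] := bound (index_enum 'I_n).
by exists B.+1 => m /ltB; rewrite mdegE.
Qed.

(** * The basis of R/I given by the monomials outside I *)

Lemma in_subalgebra0 p : in_subalgebra set0 p <-> exists c, p = c%:MP.
Proof.
split=> [supp0|[c ->] m].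
  exists p@_0; apply/mpolyP => m; rewrite mcoeffC.
  case: eqP => [->|m0]; first by rewrite mulr1.
  rewrite mulr0; apply: memN_msupp_eq0; apply/negP => /supp0 m_0.
  by apply: m0; apply/mnmP => i; rewrite m_0 ?inE ?mnm0E.
by rewrite msuppC; case: ifP => // _ /[!inE] /eqP-> i _; rewrite mnm0E.
Qed.

(** The coordinate of a class on x^mu, for x^mu outside I, is the coefficient of
    x^mu in any representative: two representatives differ by an element of I,
    whose support consists of monomials of I.  The degree bound makes the index
    set finite. *)
Lemma stanley_standard (F : 'X_{1..n} -> Prop) (B : nat) :
  monomial_ideal I ->
  (forall m, 'X_[m] \notin I -> (mdeg m < B)%N) ->
  (forall m, F m <-> 'X_[m] \notin I) ->
  stanley_decomposition I F (fun _ => set0).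
Proof.
move=> monI ltB FP.
pose outI := [pred m : 'X_{1..n < B} | 'X_[bmnm m] \notin I].
pose E := [fset bmnm m | m in outI]%fset.
have EP m : (m \in E) = ('X_[m] \notin I).
  apply/imfsetP/idP => [[m1 + ->]|mI] /=; first by [].
  by exists (BMultinom (ltB m mI)); rewrite //=.
exists E; split=> [mu|s]; first by rewrite FP EP.
have coefE (c : E -> k) (nu : E) :
    (\sum_(mu : E) 'X_[val mu] * (c mu)%:MP)@_(val nu) = c nu.
  rewrite raddf_sum (bigD1 nu) //= mulrC mcoeffCM mcoeffX eqxx mulr1.
  rewrite big1 ?addr0 // => mu munu; rewrite mulrC mcoeffCM mcoeffX.
  by rewrite (inj_eq val_inj) (negPf munu) mulr0.
pose q := [ffun mu : E => ((repr s)@_(val mu))%:MP : R].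
exists q; split.
  split=> [mu|]; first by apply/in_subalgebra0; rewrite ffunE; eexists.
  rewrite -[LHS]reprK; apply/eqP; rewrite -Quotient.idealrBE.
  apply: memI_supp => m; rewrite mcoeff_msupp mcoeffB => neq_m.
  apply: contraT; rewrite -EP => mE.
  move: neq_m; under eq_bigr do rewrite ffunE.
  by rewrite (coefE _ [` mE]%fset) subrr eqxx.
move=> q' [q'0 sE]; apply/ffunP => mu; rewrite ffunE.
have q'C (u : E) : q' u = ((q' u)@_0)%:MP.
  by have /in_subalgebra0[c ->] := q'0 u; rewrite mcoeffC eqxx mulr1.
rewrite q'C; congr _%:MP; rewrite -(coefE (fun u => (q' u)@_0)).
under eq_bigr do rewrite -q'C.
apply/eqP; rewrite -subr_eq0 -mcoeffB; apply: contraT.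
rewrite -mcoeff_msupp => /monomial_ideal_supp; move/(_ monI).
rewrite Quotient.idealrBE reprK sE eqxx => /(_ isT).
by move=> muI; have := valP mu; rewrite EP muI.
Qed.

(** * The Koszul complex in degrees n and n-1 *)

(** The sign of x_j e_T in the differential of e_(j |: T), when [j \notin T]:
    the elements of j |: T below j are those of T. *)
Definition wsign (T : {set 'I_n}) (j : 'I_n) : R :=
  (-1) ^+ #|[set l in T | (l < j)%N]|.

Lemma koszul_dE (f : koszul k n) (T : {set 'I_n}) :
  koszul_d f T = \sum_(j | j \notin T) wsign T j * 'X_j * f (j |: T).
Proof.
rewrite ffunE (exchange_big_dep xpredT) //= [RHS]big_mkcond.
apply: eq_bigr => j _; case: ifPn => jT; last first.
  rewrite big1 // => S /andP[_ /eqP defT].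
  by move: jT; rewrite -defT !inE eqxx.
rewrite (bigD1 (j |: T)) /=; last by rewrite setU11 setU1K //= eqxx.
rewrite big1 ?addr0 => [|S /andP[/andP[jS /eqP<-] /eqP[]]]; last first.
  by rewrite setD1K.
congr (_ ^+ _ * _ * _); apply: eq_card => l; rewrite !inE.
by case: (l =P j) => [->|//]; rewrite ltnn !andbF.
Qed.

Lemma card_ltn_ord (j : 'I_n) : #|[set l : 'I_n | (l < j)%N]| = j.
Proof.
transitivity (\sum_(i < j) 1)%N; last by rewrite sum1_card card_ord.
rewrite (big_ord_widen n (fun=> 1%N) (ltnW (ltn_ord j))) -sum1_card.
by apply: eq_bigl => i; rewrite inE.
Qed.

Definition codim1_supp (f : koszul k n) : Prop :=
  forall S : {set 'I_n}, #|S| != n.-1 -> f S = 0.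

(** The component of an (n-1)-chain on the complement of j, with the sign for
    which the boundary of h e_[n] has components x_j h ([cofacet_d_top]) and the
    cycle condition becomes symmetric ([koszul_cycle_codim1]). *)
Definition cofacet (f : koszul k n) (j : 'I_n) : R :=
  (-1) ^+ j * f (~: [set j]).

Lemma cofacetZ (f : koszul k n) j : cofacet f j = (-1) ^+ j *: f (~: [set j]).
Proof.
by rewrite /cofacet -[in LHS]signr_odd mulr_sign -scaler_sign signr_odd.
Qed.

Lemma cofacetK (f : koszul k n) j : f (~: [set j]) = (-1) ^+ j *: cofacet f j.
Proof. by rewrite cofacetZ scalerA -expr2 sqrr_sign scale1r. Qed.

(** Only the complements of i and of j contribute.  The signs differ because
    removing i < j lowers the number of elements below j by one and does not
    change the number of elements below i. *)
Lemma koszul_d_codim2 (f : koszul k n) (i j : 'I_n) : (i < j)%N ->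
  koszul_d f (~: [set i; j]) =
  (-1) ^+ (i + j) * ('X_i * cofacet f j - 'X_j * cofacet f i).
Proof.
move=> lt_ij; have ij : i != j by rewrite -val_eqE neq_ltn lt_ij.
have ji : j != i by rewrite eq_sym.
have Ui : i |: ~: [set i; j] = ~: [set j].
  by apply/setP => l; rewrite !inE; case: (l =P i) => [->|//]; rewrite ij.
have Uj : j |: ~: [set i; j] = ~: [set i].
  apply/setP => l; rewrite !inE orbC.
  by case: (l =P j) => [->|_]; rewrite ?ji ?orbT ?orbF.
have -> : koszul_d f (~: [set i; j]) =
    wsign (~: [set i; j]) i * 'X_i * f (~: [set j]) +
    wsign (~: [set i; j]) j * 'X_j * f (~: [set i]).
  rewrite koszul_dE (bigD1 i) ?inE ?eqxx //= Ui; congr (_ + _).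
  rewrite (bigD1 j) ?inE ?eqxx ?orbT //= Uj big1 ?addr0 // => l.
  by rewrite !inE negbK => /andP[/andP[/orP[]/eqP->]]; rewrite eqxx.
have -> : wsign (~: [set i; j]) i = (-1) ^+ i.
  congr (_ ^+ _); rewrite -[RHS](card_ltn_ord i); apply: eq_card => l.
  rewrite !inE; case: (ltngtP l i) => //; rewrite ?andbF // => lt_li.
  by rewrite -!val_eqE /= !ltn_eqF // (ltn_trans lt_li).
have -> : wsign (~: [set i; j]) j = - (-1) ^+ j.
  rewrite /wsign -[in RHS](card_ltn_ord j) (cardsD1 i) inE lt_ij.
  rewrite exprS mulN1r opprK; congr (_ ^+ _); apply: eq_card => l.
  rewrite !inE; case: (l =P i) => //= _.
  by case: (l =P j) => [->|//]; rewrite ltnn.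
rewrite /cofacet exprD; have := sqrr_sign R i; have := sqrr_sign R j.
set a := _ ^+ i; set b := _ ^+ j => b2 a2.
transitivity (a * b ^+ 2 * 'X_i * f (~: [set j])
  - a ^+ 2 * b * 'X_j * f (~: [set i])); last by ring.
by rewrite a2 b2; ring.
Qed.

Lemma codim1P (S : {set 'I_n}) :
  (0 < n)%N -> reflect (exists j, S = ~: [set j]) (#|S| == n.-1).
Proof.
move=> n_gt0; apply: (iffP eqP) => [cS|[j ->]]; last first.
  by rewrite cardsC1 card_ord.
have /cards1P[j defj] : #|~: S| == 1%N.
  rewrite cardsCs setCK cS card_ord.
  by case: n n_gt0 => // n' _; rewrite subSnn.
by exists j; rewrite -defj setCK.
Qed.

Definition koszul_top (h : R) : koszul k n :=
  [ffun S => if S == setT then h else 0].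

Lemma cofacet_d_top h j : cofacet (koszul_d (koszul_top h)) j = 'X_j * h.
Proof.
rewrite /cofacet koszul_dE (big_pred1 j) => [|l]; last by rewrite !inE negbK.
rewrite ffunE setUCr eqxx.
have -> : wsign (~: [set j]) j = (-1) ^+ j.
  congr (_ ^+ _); rewrite -[RHS](card_ltn_ord j); apply: eq_card => l.
  by rewrite !inE; case: (l =P j) => [->|//]; rewrite ltnn.
have := sqrr_sign R j; set a := _ ^+ j => a2.
transitivity (a ^+ 2 * 'X_j * h); first by ring.
by rewrite a2; ring.
Qed.

Lemma koszul_d_top_supp h : (0 < n)%N -> codim1_supp (koszul_d (koszul_top h)).
Proof.
move=> n_gt0 S cS; rewrite koszul_dE big1 // => j jS.
rewrite ffunE; case: eqP => [defS|]; last by rewrite mulr0.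
case/negP: cS; apply/codim1P => //; exists j.
by rewrite -(setU1K jS) defS setTD.
Qed.

Lemma koszul_codim1_eq (f g : koszul k n) : (0 < n)%N ->
  codim1_supp f -> codim1_supp g ->
  cofacet f =1 cofacet g -> f = g.
Proof.
move=> n_gt0 f0 g0 fg; apply/ffunP => S.
have [/(codim1P _ n_gt0)[j ->]|cS] := boolP (#|S| == n.-1).
  by apply: (mulfI (_ : (-1) ^+ j != 0)); [rewrite signr_eq0|exact: fg].
by rewrite f0 // g0.
Qed.

(** The cycle condition says that the components are proportional to the
    variables, as those of the boundary of h e_[n] are. *)
Lemma koszul_cycle_codim1 (f : koszul k n) : (0 < n)%N ->
  codim1_supp f ->
  koszul_d f = [ffun=> 0] <->
  forall i j, 'X_i * cofacet f j = 'X_j * cofacet f i.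
Proof.
move=> n_gt0 f0; split=> [df0 i j|eqf].
  wlog lt_ij : i j / (i < j)%N.
    move=> WL; case: (ltngtP i j) => [/WL //|/WL //|/val_inj-> //].
  have := koszul_d_codim2 f lt_ij; rewrite df0 ffunE => /esym/eqP.
  by rewrite mulf_eq0 signr_eq0 subr_eq0 => /eqP.
apply/ffunP => T; rewrite [RHS]ffunE.
have [/existsP[i /existsP[j /andP[lt_ij /eqP->]]]|noT] :=
    boolP [exists i : 'I_n, exists j : 'I_n, (i < j)%N && (T == ~: [set i; j])].
  by rewrite koszul_d_codim2 // eqf subrr mulr0.
rewrite koszul_dE big1 // => i iT; rewrite f0 ?mulr0 //.
apply: contra noT => /(codim1P _ n_gt0)[j defT].
have ij : i != j by have := setU11 i T; rewrite defT !inE.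
have {}defT : T = ~: [set i; j].
  by rewrite -(setU1K iT) defT; apply/setP => l; rewrite !inE negb_or.
apply/existsP; case: (ltngtP i j) => [lt_ij|lt_ji|/val_inj/eqP].
- by exists i; apply/existsP; exists j; rewrite lt_ij defT eqxx.
- by exists j; apply/existsP; exists i; rewrite lt_ji defT setUC eqxx.
- by rewrite (negPf ij).
Qed.
Lemma mdeg_wedgeT (j : 'I_n) :
  mdeg_wedge setT = (U_(j) + mdeg_wedge (~: [set j]))%MM.
Proof.
apply/mnmP => i; rewrite mnmDE mnm1E !mnmE !inE eq_sym.
by case: (_ == _).
Qed.

(** * Top homology and the socle *)

(** Tor_(n-1)(I, k) = Tor_n(R/I, k) is the socle of R/I shifted by (1,...,1).
    A cycle f <> 0 of multidegree nu with coefficients in I has the form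
    d(h e_[n]) for a scalar multiple h of x^mu, mu = nu - 1; it bounds over I iff
    h is in I. *)
Lemma koszul_homology_codim1P nu : (0 < n)%N ->
  koszul_homology_neq0 I n.-1 nu <->
  exists mu, [/\ nu = (mu + mdeg_wedge setT)%MM, 'X_[mu] \notin I
                & forall j, 'X_[mu + U_(j)] \in I].
Proof.
move=> n_gt0; split=> [[f [[fch df0] notbd]]|[mu [-> muI sockI]]].
- have f0 : codim1_supp f.
    move=> S cS; apply/eqP; apply: contraNT cS => fS.
    by have [_ /(_ fS)-> _] := fch S.
  have eqf := (koszul_cycle_codim1 n_gt0 f0).1 df0.
  have [j0 fj0] : exists j, f (~: [set j]) != 0.
    apply/existsP; apply: contraT; rewrite negb_exists => /forallP all0.
    case: notbd; exists [ffun=> 0]; split.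
      by move=> S; rewrite ffunE eqxx msupp0 rpred0; split.
    apply/ffunP => S; rewrite koszul_dE big1 => [|j _]; last first.
      by rewrite ffunE mulr0.
    have [/(codim1P _ n_gt0)[j ->]|/f0 //] := boolP (#|S| == n.-1).
    by apply/eqP; rewrite -[_ == _]negbK all0.
  have [pI _ deg] := fch (~: [set j0]).
  set p := f _ in fj0 pI deg; pose m := mlead p; pose c := p@_m.
  have c0 : c != 0 by rewrite mleadc_eq0.
  have defp : p = c *: 'X_[m].
    apply/mpolyP => m'; rewrite mcoeffZ mcoeffX.
    case: eqP => [<-|mm']; first by rewrite mulr1.
    rewrite mulr0; apply: memN_msupp_eq0; apply/negP => /deg degm'; apply: mm'.
    apply: (@addIm _ (mdeg_wedge (~: [set j0]))).
    by rewrite degm' deg // mlead_supp.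
  have mI : 'X_[m] \in I by rewrite -(memI_unitZ _ c0) -defp.
  (* x_j0 divides the component p of f.  Some x_j divides p since I is proper;
     if j != j0, then x_j p is up to sign x_j0 times another component of f. *)
  have mj0 : m j0 != 0%N.
    apply/negP => /eqP mj0.
    have [j mj] : exists j, m j != 0%N.
      apply/existsP; apply: contraT; rewrite negb_exists => /forallP m_0.
      move: mI; suff -> : m = 0%MM by rewrite mpolyX0 idealr1.
      by apply/mnmP => j; rewrite mnm0E; apply/eqP; rewrite -[_ == _]negbK m_0.
    have jj0 : (j == j0) = false by apply: contraNF mj => /eqP->; rewrite mj0.
    have : (U_(j) + m)%MM \in msupp (cofacet f j * 'X_j0).
      rewrite mcoeff_msupp mulrC -eqf mulrC mcoeffMX cofacetZ mcoeffZ.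
      by rewrite mulf_neq0 ?signr_eq0.
    rewrite (perm_mem (msuppMX _ _)) => /mapP[m' _].
    move=> /(congr1 (fun u : 'X_{1..n} => u j0)).
    by rewrite /= !mnmDE !mnm1E jj0 eqxx mj0.
  pose mu := (m - U_(j0))%MM.
  have defm : m = (mu + U_(j0))%MM by rewrite submK // lep1mP.
  pose h : R := ((-1) ^+ j0 * c) *: 'X_[mu].
  (* Cancelling x_j0 in the cycle condition shows f = d(h e_[n]). *)
  have cofE j : cofacet f j = 'X_j * h.
    apply: (mulfI (_ : 'X_j0 != 0)); first by rewrite -msupp_eq0 msuppX.
    rewrite eqf [RHS]mulrCA; congr (_ * _); rewrite cofacetZ -/p defp scalerA.
    by rewrite -scalerAr -mpolyXD addmC -defm.
  have s0 : (-1) ^+ j0 * c != 0 by rewrite mulf_neq0 ?signr_eq0.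
  exists mu; split.
  + by rewrite (mdeg_wedgeT j0) addmA -defm deg // mlead_supp.
  + apply/negP => muI; apply: notbd; exists (koszul_top h); split.
      move=> S; rewrite ffunE; case: eqP => [->|_]; last first.
        by rewrite msupp0 eqxx rpred0; split.
      split; first by rewrite memI_unitZ.
        by rewrite cardsT card_ord prednK.
      move=> m'; rewrite msuppMCX // mem_seq1 => /eqP->.
      by rewrite (mdeg_wedgeT j0) addmA -defm deg // mlead_supp.
    apply: koszul_codim1_eq => // [|j]; first exact: koszul_d_top_supp.
    by rewrite cofE cofacet_d_top.
  + move=> j; have [fjI _ _] := fch (~: [set j]).
    rewrite -(memI_unitZ _ s0) addmC mpolyXD scalerAr -/h -cofE cofacetZ.
    by rewrite memI_unitZ ?signr_eq0.
pose f := koszul_d (koszul_top 'X_[mu]).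
have f0 : codim1_supp f by exact: koszul_d_top_supp.
have fE j : f (~: [set j]) = (-1) ^+ j *: 'X_[U_(j) + mu].
  by rewrite cofacetK cofacet_d_top mpolyXD.
exists f; split; first split.
- move=> S; have [/(codim1P _ n_gt0)[j ->]|/f0->] := boolP (#|S| == n.-1).
    rewrite fE; split; first by rewrite memI_unitZ ?signr_eq0 // addmC.
      by rewrite cardsC1 card_ord.
    move=> m; rewrite msuppMCX ?signr_eq0 // mem_seq1 => /eqP->.
    by rewrite (mdeg_wedgeT j) addmA; congr (_ + _)%MM; rewrite addmC.
  by rewrite msupp0 eqxx rpred0; split.
- by apply/(koszul_cycle_codim1 n_gt0 f0) => i j; rewrite !cofacet_d_top mulrCA.
(* An n-chain is g e_[n], and its boundary determines g. *)
move=> [g [gch fg]].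
have gtop : g = koszul_top (g setT).
  apply/ffunP => S; rewrite ffunE; case: (S =P setT) => [->//|ST].
  apply/eqP; apply: contraT => gS; have [_ /(_ gS) cS _] := gch S; case: ST.
  by apply/eqP; rewrite eqEcard subsetT cardsT card_ord cS prednK /=.
pose j := Ordinal n_gt0.
have := cofacet_d_top 'X_[mu] j; rewrite -/f fg gtop cofacet_d_top.
have Xj0 : 'X_j != 0 :> R by rewrite -msupp_eq0 msuppX.
move=> /(mulfI Xj0) gmu; have [gI _ _] := gch setT.
by rewrite -gmu gI in muI.
Qed.

(** Multiplying by variables as long as the product stays outside I must stop,
    by the degree bound, and it stops at a socle monomial. *)
Lemma socle_above (B : nat) mu :
  (forall m, 'X_[m] \notin I -> (mdeg m < B)%N) ->
  'X_[mu] \notin I ->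
  exists mu', [/\ (mu <= mu')%MM, 'X_[mu'] \notin I
                & forall j, 'X_[mu' + U_(j)] \in I].
Proof.
move=> ltB; have [d] := ubnP (B - mdeg mu); elim: d mu => // d IHd mu leBd muI.
have [sock|] := boolP [forall j, 'X_[mu + U_(j)] \in I].
  by exists mu; split=> //; [exact: lepm_refl|exact/forallP].
rewrite negb_forall => /existsP[j jI].
have [|mu' [le_mu' mu'I sock]] := IHd _ _ jI.
  by have := ltB _ jI; rewrite mdegD mdeg1; lia.
by exists mu'; split=> //; apply: lepm_trans le_mu'; apply: lem_addr.
Qed.

Lemma mbar_addT mu : mbar (mu + mdeg_wedge setT) = mu.
Proof. by apply/mnmP => i; rewrite !mnmE inE addn1. Qed.

End MonomialIdeals.

Theorem proposition2p2p15 (k : fieldType) (n : nat)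
    (char0 : [pchar k] =i pred0) (n_gt0 : (0 < n)%N)
    (I : idealr {mpoly k[n]}) (artI : artinian_monomial_ideal I) :
  stanley_decomposition I
    (fun mu : 'X_{1..n} => exists nu : 'X_{1..n},
       koszul_homology_neq0 I n.-1 nu /\ (mu <= mbar nu)%MM)
    (fun _ => set0).
Proof.
have [monI _] := artI; have [B ltB] := artinian_mdeg_bound artI.
apply: (stanley_standard monI ltB) => mu; split.
  move=> [nu [/(koszul_homology_codim1P _ _ n_gt0)[mu' [-> mu'I _]]]].
  by rewrite mbar_addT => le_mu; apply: contra mu'I; apply: memI_lem.
move=> /(socle_above ltB)[mu' [le_mu mu'I sock]].
exists (mu' + mdeg_wedge setT)%MM; rewrite mbar_addT; split=> //.
by apply/(koszul_homology_codim1P _ _ n_gt0); exists mu'.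
Qed.
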